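(* Let $n\in\mathbb{N}$, $n\geq 1$, and let $$\mathbb{U}=\left\{u:\mathbb{R}^n\to\mathbb{R}\ \middle|\ u(x_1,\dots,x_n)=\sum_{k=1}^{n}c_kx_k \text{ for some } c_1,\dots,c_n\in\mathbb{R} \text{ with } c_n=\frac{1}{n} \text{ and } \sum_{k=1}^{n}c_k=1\right\}.$$ Then every $u\in\mathbb{U}$ solves the partial differential equation $$\sum_{k=1}^{n}\frac{\partial u}{\partial x_k}=n\frac{\partial u}{\partial x_n}$$ on $\mathbb{R}^n$, and every $u\in\mathbb{U}$ belongs to the Ouroboros space $\mathbf{O}(\mathbb{R}^n)$.
   Context: For a set $A$ and $n\in\mathbb{N}$, $n\ge 1$, the Ouroboros space $\mathbf{O}(A^n)$ is the set of all functions $f:A^n\to B$, where $B$ is any subset of $A$, such that $f(f(\mathbf{x}),\dots,f(\mathbf{x}))=f(\mathbf{x})$ for all $\mathbf{x}\in A^n$ (with $f(\mathbf{x})$ repeated $n$ times on the left). *)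

(* Defs.v *)
From HB Require Import structures.
From mathcomp Require Import all_boot all_order all_algebra.
From mathcomp Require Import all_classical all_reals all_analysis.
Import numFieldNormedType.Exports.

Set Implicit Arguments.
Unset Strict Implicit.
Unset Printing Implicit Defensive.

Import Order.TTheory GRing.Theory Num.Theory.
Local Open Scope classical_set_scope.
Local Open Scope ring_scope.

(* The set A is the carrier type and A^n is 'rV[A]_n. A function into a subset
   B of A is a function into A whose values all lie in B; const_mx y is the
   n-tuple (y, ..., y). *)
Definition ouroboros (A : Type) (n : nat) : set ('rV[A]_n -> A) :=
  [set f | exists2 B : set A, range f `<=` B &
             forall x : 'rV[A]_n, f (const_mx (f x)) = f x].
Arguments ouroboros A n : clear implicits.

(* From here on a dimension n >= 1 is written n.+1, so that the last index
   exists: it is ord_max. *)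

Definition linU (R : realType) (n : nat) : set ('rV[R]_n.+1 -> R) :=
  [set u | exists c : 'I_n.+1 -> R,
     [/\ forall x : 'rV[R]_n.+1, u x = \sum_(k < n.+1) c k * x ord0 k,
         c ord_max = 1 / n.+1%:R
       & \sum_(k < n.+1) c k = 1]].
Arguments linU R n : clear implicits.

(* Partial derivative along the k-th vector of the canonical basis. *)
Definition partial (R : realType) (n : nat) (k : 'I_n.+1)
    (u : 'rV[R]_n.+1 -> R) (x : 'rV[R]_n.+1) : R :=
  'D_(delta_mx ord0 k) u x.

(* 'D_v u x is a total operator, with an unspecified value when the limit does
   not exist; existence of the partial derivatives is therefore part of being
   a solution. *)
Definition solves_pde (R : realType) (n : nat) (u : 'rV[R]_n.+1 -> R) : Prop :=
  forall x : 'rV[R]_n.+1,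
    (forall k : 'I_n.+1, derivable u x (delta_mx ord0 k)) /\
    \sum_(k < n.+1) partial k u x = n.+1%:R * partial ord_max u x.

(* Main.v *)
Require Import Defs.
From mathcomp Require Import all_boot all_order all_algebra.
From mathcomp Require Import all_classical all_reals all_analysis.

Import GRing.Theory Num.Theory.
Import numFieldNormedType.Exports.

Local Open Scope classical_set_scope.
Local Open Scope ring_scope.

(** A member [u] of [linU R n] is a linear form, so its difference quotients in
the direction [v] are all equal to [u v] and its k-th partial derivative is the
coefficient [c k] ([is_derive_linear_form]).  Both sides of the differential
equation are then equal to 1: the left one is the sum of the coefficients, and
the right one is n.+1 times the last coefficient 1 / n.+1.  Since the
coefficients sum to 1, [u] sends the constant tuple (y, ..., y) to y, which for
y = u x is the Ouroboros equation. *)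

(** By linearity the difference quotient (u (h *: v + x) - u x) / h equals [u v]
for every h != 0. *)
Lemma is_derive_linear_form (R : realType) (V : normedModType R) (u : V -> R)
    (x v : V) :
  (forall (h : R) (y z : V), u (h *: y + z) = h * u y + u z) ->
  is_derive x v u (u v).
Proof.
move=> u_lin.
have quot_cvg : (fun h : R => h^-1 *: ((u \o shift x) (h *: v) - u x)) @ 0^'
    --> u v.
  apply: cvg_near_cst; near=> h.
  have h0 : h != 0 by near: h; exact: nbhs_dnbhs_neq.
  by rewrite /= u_lin addrK /GRing.scale /= mulKf.
split; first by apply/cvg_ex; exists (u v).
exact: cvg_lim quot_cvg.
Unshelve. all: by end_near.
Qed.

Theorem mainTheorem3 (R : realType) (n : nat) :
  (forall u : 'rV[R]_n.+1 -> R, linU R n u -> solves_pde u) /\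
  (forall u : 'rV[R]_n.+1 -> R, linU R n u -> ouroboros R n.+1 u).
Proof.
split=> u [c [uE c_last c_sum]].
- have u_lin (h : R) (y z : 'rV[R]_n.+1) : u (h *: y + z) = h * u y + u z.
    rewrite !uE mulr_sumr -big_split; apply: eq_bigr => k _ /=.
    by rewrite !mxE mulrDr mulrCA.
  have u_basis k : u (delta_mx ord0 k) = c k.
    rewrite uE (bigD1 k) //= mxE !eqxx mulr1 big1 ?addr0 // => j /negPf jk.
    by rewrite mxE jk andbF mulr0.
  have partialE x k : partial k u x = c k.
    have := is_derive_linear_form _ _ _ x (delta_mx ord0 k) u_lin.
    by rewrite u_basis => du; exact: derive_val.
  move=> x; split=> [k|].
    by case: (is_derive_linear_form _ _ _ x (delta_mx ord0 k) u_lin).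
  rewrite (eq_bigr c) => [|k _]; last exact: partialE.
  by rewrite partialE c_sum c_last mulrC divfK // pnatr_eq0.
- exists setT => // x.
  (* [c_sum] turns the right-hand side u x = 1 * u x into a sum of c k * u x. *)
  rewrite [LHS]uE -[RHS]mul1r -c_sum mulr_suml.
  by apply: eq_bigr => k _; rewrite mxE.
Qed.
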